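(* Let $n\geq 3$ and let $\Gamma=SL_n(\mathbb{Z})\ltimes\mathcal{M}_n(\mathbb{Z})$, where $SL_n(\mathbb{Z})$ acts on the additive group $\mathcal{M}_n(\mathbb{Z})$ of $n\times n$ integer matrices by left multiplication. For $\delta\in SL_n(\mathbb{Z})$, let $S_\delta:\Gamma\to\Gamma$ be defined by $S_\delta((\alpha,A))=(\alpha,A\delta)$ for all $(\alpha,A)\in\Gamma$. Then: (a) $S_\delta\in \mathrm{Aut}(\Gamma)$. (b) The map $\Phi:SL_n(\mathbb{Z})\to \mathrm{Aut}(\Gamma)$, $\Phi(\delta)=S_\delta$, is a group homomorphism. (c) $S_\delta\in \mathrm{Int}(\Gamma)$ if and only if $\delta\in\{\pm I\}$, where $I$ is the $n\times n$ identity matrix. In particular, the outer automorphism group $\mathrm{Out}(\Gamma)=\mathrm{Aut}(\Gamma)/\mathrm{Int}(\Gamma)$ is infinite.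
   Context: The group $\Gamma=SL_n(\mathbb{Z})\ltimes\mathcal{M}_n(\mathbb{Z})$ is the set $SL_n(\mathbb{Z})\times\mathcal{M}_n(\mathbb{Z})$ with multiplication $(\alpha_1,A_1)(\alpha_2,A_2)=(\alpha_1\alpha_2,A_1+\alpha_1A_2)$. $\mathrm{Aut}(\Gamma)$ is the automorphism group of $\Gamma$, and $\mathrm{Int}(\Gamma)$ is its normal subgroup of inner automorphisms $x\mapsto gxg^{-1}$, $g\in\Gamma$.
   Formalization: In (b) the product in Aut(Γ) is read from left to right, (fg)(x) = g(f(x)); with the usual composition (fg)(x) = f(g(x)) one has S_δ1 S_δ2 = S_(δ2δ1), so Φ would be an antihomomorphism and not a homomorphism. *)

(* Defs.v *)
From HB Require Import structures.
From mathcomp Require Import all_boot all_algebra all_classical.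
From mathcomp Require Import generic_quotient.

Set Implicit Arguments.
Unset Strict Implicit.
Unset Printing Implicit Defensive.

Import GRing.Theory.

Local Open Scope classical_set_scope.
Local Open Scope quotient_scope.
Local Open Scope group_scope.
Local Open Scope ring_scope.

Record SL (n : nat) := MkSL { slmx :> 'M[int]_n; _ : \det slmx == 1 }.

HB.instance Definition _ n := [isSub for @slmx n].
HB.instance Definition _ n := [Choice of SL n by <:].

Section SLGroup.
Variable n : nat.
Implicit Types a b c : SL n.

Lemma det_SL a : \det a = 1.
Proof. exact/eqP/(valP a). Qed.

Lemma SL_unitmx a : slmx a \in unitmx.
Proof. by rewrite unitmxE det_SL unitr1. Qed.

Fact SL_mul_proof a b : \det (a *m b) == 1.
Proof. by rewrite det_mulmx !det_SL mulr1. Qed.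
Fact SL_one_proof : \det (1%:M : 'M[int]_n) == 1.
Proof. by rewrite det1. Qed.
Fact SL_inv_proof a : \det (invmx a) == 1.
Proof. by rewrite det_inv det_SL invr1. Qed.

Definition SL_mul a b := MkSL (SL_mul_proof a b).
Definition SL_one := MkSL SL_one_proof.
Definition SL_inv a := MkSL (SL_inv_proof a).

Fact SL_mulA : associative SL_mul.
Proof. by move=> a b c; apply: val_inj; rewrite /= mulmxA. Qed.
Fact SL_mul1 : left_id SL_one SL_mul.
Proof. by move=> a; apply: val_inj; rewrite /= mul1mx. Qed.
Fact SL_mul1r : right_id SL_one SL_mul.
Proof. by move=> a; apply: val_inj; rewrite /= mulmx1. Qed.
Fact SL_mulV : left_inverse SL_one SL_inv SL_mul.
Proof. by move=> a; apply: val_inj; rewrite /= mulVmx ?SL_unitmx. Qed.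
Fact SL_mulVr : right_inverse SL_one SL_inv SL_mul.
Proof. by move=> a; apply: val_inj; rewrite /= mulmxV ?SL_unitmx. Qed.

HB.instance Definition _ :=
  isGroup.Build (SL n) SL_mulA SL_mul1 SL_mul1r SL_mulV SL_mulVr.

End SLGroup.

(* An alias, so that the semidirect product law below does not compete with
   the componentwise group law of the product type. *)
Definition Gamma (n : nat) : Type := (SL n * 'M[int]_n)%type.

HB.instance Definition _ n := Choice.copy (Gamma n) (SL n * 'M[int]_n)%type.

Section GamGroup.
Variable n : nat.
Implicit Types x y z : Gamma n.

Definition Gamma_mul x y : Gamma n := ((x.1 * y.1)%g, x.2 + x.1 *m y.2).
Definition Gamma_one : Gamma n := (1%g, 0).
Definition Gamma_inv x : Gamma n := (x.1^-1%g, - ((x.1^-1)%g *m x.2)).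

Fact Gamma_mulA : associative Gamma_mul.
Proof.
by move=> x y z; congr pair; [exact: mulgA | rewrite /= mulmxDr mulmxA addrA].
Qed.
Fact Gamma_mul1 : left_id Gamma_one Gamma_mul.
Proof.
by case=> a A; congr pair; [exact: mul1g | rewrite /= mul1mx add0r].
Qed.
Fact Gamma_mul1r : right_id Gamma_one Gamma_mul.
Proof.
by case=> a A; congr pair; [exact: mulg1 | rewrite /= mulmx0 addr0].
Qed.
Fact Gamma_mulV : left_inverse Gamma_one Gamma_inv Gamma_mul.
Proof. by case=> a A; congr pair; [exact: mulVg | rewrite /= addNr]. Qed.
Fact Gamma_mulVr : right_inverse Gamma_one Gamma_inv Gamma_mul.
Proof.
case=> a A; congr pair; first exact: mulgV.
by rewrite /= mulmxN mulmxA mulmxV ?SL_unitmx // mul1mx subrr.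
Qed.

HB.instance Definition _ :=
  isGroup.Build (Gamma n) Gamma_mulA Gamma_mul1 Gamma_mul1r
    Gamma_mulV Gamma_mulVr.

End GamGroup.

Section Automorphisms.
Variable G : groupType.

Definition automorphism (f : G -> G) : Prop :=
  {morph f : x y / (x * y)%g} /\ bijective f.

Record AutGroup := MkAut { aut_fun :> G -> G; _ : `[< automorphism aut_fun >] }.

HB.instance Definition _ := [isSub for aut_fun].
HB.instance Definition _ := [Choice of AutGroup by <:].

Implicit Types f g h : AutGroup.

Lemma autP f : automorphism f.
Proof. exact/asboolP/(valP f). Qed.

Lemma aut_mulg f x y : f (x * y)%g = (f x * f y)%g.
Proof. by case: (autP f) => ->. Qed.

Fact aut_inv_ex f : exists h : G -> G, cancel f h /\ cancel h f.
Proof. by case: (autP f) => _ [h fK hK]; exists h. Qed.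

Definition aut_inv_fun f : G -> G := projT1 (cid (aut_inv_ex f)).

Lemma aut_funK f : cancel f (aut_inv_fun f).
Proof. by rewrite /aut_inv_fun; case: cid => h []. Qed.
Lemma aut_inv_funK f : cancel (aut_inv_fun f) f.
Proof. by rewrite /aut_inv_fun; case: cid => h []. Qed.

Fact aut_mul_proof f g : `[< automorphism (g \o f) >].
Proof.
apply/asboolP; split=> [x y|]; first by rewrite /= !aut_mulg.
by apply: bij_comp; [case: (autP g) | case: (autP f)].
Qed.
Fact aut_one_proof : `[< automorphism idfun >].
Proof. by apply/asboolP; split=> //; exists idfun. Qed.
Fact aut_inv_proof f : `[< automorphism (aut_inv_fun f) >].
Proof.
apply/asboolP; split; last first.
  by exists f; [exact: aut_inv_funK | exact: aut_funK].
move=> x y; apply: (can_inj (aut_funK f)).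
by rewrite aut_mulg !aut_inv_funK.
Qed.

(* Products of automorphisms are read from left to right, (f * g) x = g (f x),
   as for {perm T} and for the groups Aut G of finite groups. The order matters
   for d |-> S_ d below: S_ d2 \o S_ d1 = S_ (d1 * d2), so this map is a
   homomorphism for this law, and an antihomomorphism for the opposite one. *)
Definition aut_mul f g := MkAut (aut_mul_proof f g).
Definition aut_one := MkAut aut_one_proof.
Definition aut_inv f := MkAut (aut_inv_proof f).

Fact aut_mulA : associative aut_mul.
Proof. by move=> f g h; apply: val_inj. Qed.
Fact aut_mul1 : left_id aut_one aut_mul.
Proof. by move=> f; apply: val_inj. Qed.
Fact aut_mul1r : right_id aut_one aut_mul.
Proof. by move=> f; apply: val_inj. Qed.
Fact aut_mulV : left_inverse aut_one aut_inv aut_mul.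
Proof.
by move=> f; apply: val_inj; apply/funext => x /=; exact: aut_inv_funK.
Qed.
Fact aut_mulVr : right_inverse aut_one aut_inv aut_mul.
Proof. by move=> f; apply: val_inj; apply/funext => x /=; exact: aut_funK. Qed.

HB.instance Definition _ :=
  isGroup.Build AutGroup aut_mulA aut_mul1 aut_mul1r aut_mulV aut_mulVr.

Definition inner (g : G) : G -> G := fun x => (g * x * g^-1)%g.

Definition IntAut : set (G -> G) := range inner.

Lemma inner1 : inner 1%g = idfun.
Proof. by apply/funext => x; rewrite /inner invg1 mulg1 mul1g. Qed.
Lemma innerM a b : inner (a * b)%g = inner a \o inner b.
Proof. by apply/funext => x; rewrite /inner /= invgM !mulgA. Qed.

Lemma inner_automorphism a : automorphism (inner a).
Proof.
split=> [x y|]; first by rewrite /inner !mulgA mulgVK.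
exists (inner a^-1%g) => x.
  by rewrite -[LHS]/((_ \o _) x) -innerM mulVg inner1.
by rewrite -[LHS]/((_ \o _) x) -innerM mulgV inner1.
Qed.

Lemma Int1 : IntAut (1%g : AutGroup).
Proof. by exists 1%g => //; rewrite inner1. Qed.
Lemma IntM f g : IntAut f -> IntAut g -> IntAut (f * g)%g.
Proof.
by case=> a _ fE [b _ gE]; exists (b * a)%g => //; rewrite innerM fE gE.
Qed.
Lemma IntV f : IntAut f -> IntAut (f^-1)%g.
Proof.
case=> a _ fE; exists a^-1%g => //; apply/funext => x.
apply: (can_inj (aut_funK f)); rewrite [RHS]aut_inv_funK -fE.
by rewrite -[LHS]/((_ \o _) x) -innerM mulgV inner1.
Qed.
Lemma IntJ f g : IntAut f -> IntAut (g^-1 * f * g)%g.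
Proof.
case=> a _ fE; exists (g a) => //; apply/funext => x.
rewrite -[RHS]/(g (f (aut_inv_fun g x))) -fE /inner !aut_mulg aut_inv_funK.
congr (_ * _)%g; apply: (mulgI (g a)).
rewrite mulgV -aut_mulg mulgV.
by apply: (mulgI (g 1%g)); rewrite -aut_mulg !mulg1.
Qed.

Definition int_eqv : rel AutGroup := fun f g => `[< IntAut (f^-1 * g)%g >].

Fact int_eqv_refl : reflexive int_eqv.
Proof. by move=> f; apply/asboolP; rewrite mulVg; exact: Int1. Qed.
Fact int_eqv_sym : symmetric int_eqv.
Proof.
by move=> f g; apply/asboolP/asboolP => /IntV; rewrite invgM invgK.
Qed.
Fact int_eqv_trans : transitive int_eqv.
Proof.
move=> g f h /asboolP fg /asboolP gh; apply/asboolP.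
by have := IntM fg gh; rewrite mulgA mulgK.
Qed.

Canonical int_equiv := EquivRel int_eqv int_eqv_refl int_eqv_sym int_eqv_trans.

Definition OutGroup : Type := {eq_quot int_equiv}.

HB.instance Definition _ := Choice.copy OutGroup {eq_quot int_equiv}.
HB.instance Definition _ := EqQuotient.copy OutGroup {eq_quot int_equiv}.

Definition out_mul (u v : OutGroup) : OutGroup :=
  \pi_OutGroup (repr u * repr v)%g.
Definition out_one : OutGroup := \pi_OutGroup 1%g.
Definition out_inv (u : OutGroup) : OutGroup := \pi_OutGroup (repr u)^-1%g.

Lemma out_eqP f g : \pi_OutGroup f = \pi_OutGroup g <-> IntAut (f^-1 * g)%g.
Proof.
split=> [/eqmodP|] fg; first exact/asboolP.
by apply/eqmodP/asboolP.
Qed.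

Lemma out_mulE f g :
  out_mul (\pi_OutGroup f) (\pi_OutGroup g) = \pi_OutGroup (f * g)%g.
Proof.
have [ff' gg'] : IntAut ((repr (\pi_OutGroup f))^-1 * f)%g /\
    IntAut ((repr (\pi_OutGroup g))^-1 * g)%g.
  by split; apply/out_eqP; rewrite reprK.
apply/out_eqP; move: (repr _) (repr _) ff' gg' => g' f' ff' gg'.
have := IntM (IntJ g' ff') gg'.
by rewrite !invgM !mulgA mulgK.
Qed.

Lemma out_invE f : out_inv (\pi_OutGroup f) = \pi_OutGroup f^-1%g.
Proof.
have ff' : IntAut ((repr (\pi_OutGroup f))^-1 * f)%g.
  by apply/out_eqP; rewrite reprK.
apply/out_eqP; move: (repr _) ff' => f' ff'.
by have := IntJ f'^-1%g (IntV ff'); rewrite invgM !invgK !mulgA mulgK.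
Qed.

Fact out_mulA : associative out_mul.
Proof.
move=> u v w; rewrite -[u]reprK -[v]reprK -[w]reprK.
move: (repr u) (repr v) (repr w) => f g h.
by rewrite (out_mulE g h) (out_mulE f g) 2!out_mulE mulgA.
Qed.
Fact out_mul1 : left_id out_one out_mul.
Proof. by move=> u; rewrite -[u]reprK out_mulE mul1g. Qed.
Fact out_mul1r : right_id out_one out_mul.
Proof. by move=> u; rewrite -[u]reprK out_mulE mulg1. Qed.
Fact out_mulV : left_inverse out_one out_inv out_mul.
Proof. by move=> u; rewrite -[u]reprK out_invE out_mulE mulVg. Qed.
Fact out_mulVr : right_inverse out_one out_inv out_mul.
Proof. by move=> u; rewrite -[u]reprK out_invE out_mulE mulgV. Qed.

HB.instance Definition _ :=
  isGroup.Build OutGroup out_mulA out_mul1 out_mul1r out_mulV out_mulVr.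

End Automorphisms.

Arguments IntAut : clear implicits.

Definition S_ (n : nat) (d : SL n) (x : Gamma n) : Gamma n :=
  (x.1, x.2 *m d).

(* Main.v *)
(* If S_d is conjugation by (g, B), comparing the images of (1, A) gives
   g A = A d for all A; A = I yields g = d, so d is central among all matrices,
   hence scalar with determinant 1, hence d = 1 or d = -1.  The transvections
   1 + k E_{n1} are pairwise distinct up to sign, so the corresponding S_d have
   pairwise distinct classes in Out(Gamma). *)

Require Import Defs.
From HB Require Import structures.
From mathcomp Require Import all_boot all_algebra all_classical.

Import GRing.Theory Num.Theory.

Local Open Scope ring_scope.

(** Entry [(i, 0)] of the commutation with [delta_mx j 0] gives [A i j = A 0 0] when [i = j], and
    [A i j = 0] otherwise. *)
Lemma comm_all_is_scalar (R : pzRingType) (n : nat) (A : 'M[R]_n) :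
  (forall B, A *m B = B *m A) -> is_scalar_mx A.
Proof.
case: n A => [|n] A comA.
  by apply/is_scalar_mxP; exists 0; apply/matrixP => -[].
apply/is_scalar_mxP; exists (A 0 0); apply/matrixP=> i j.
have /matrixP/(_ i 0) := comA (delta_mx j 0).
rewrite !mxE (bigD1 j) //= big1 => [|k /negPf kj]; last first.
  by rewrite !mxE kj mulr0.
rewrite (bigD1 0) //= big1 => [|k /negPf k0]; last first.
  by rewrite !mxE k0 andbF mul0r.
by rewrite !mxE !eqxx !andbT mulr1 !addr0 mulr_natl.
Qed.

Lemma int_exp_eq1 (a : int) (n : nat) :
  (0 < n)%N -> a ^+ n = 1 -> a = 1 \/ a = - 1.
Proof.
move=> n_gt0 an1.
have : `|a| ^+ n == 1 by rewrite -normrX an1 normr1.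
rewrite pexpr_eq1 // -sqr_norm_eq1 ?num_real // sqrf_eq1.
by case/orP => /eqP; [left | right].
Qed.

Lemma S_automorphism {n : nat} (d : SL n) : automorphism (S_ d).
Proof.
split=> [[a A] [b B]|].
  by congr pair; rewrite /= mulmxDl mulmxA.
exists (S_ d^-1%g) => -[a A]; congr pair; rewrite /= -mulmxA.
  by rewrite mulmxV ?SL_unitmx // mulmx1.
by rewrite mulVmx ?SL_unitmx // mulmx1.
Qed.

Definition S_aut {n : nat} (d : SL n) : AutGroup (Gamma n) :=
  MkAut (introT (asboolP _) (S_automorphism d)).

Lemma S_autM (n : nat) : {morph @S_aut n : d e / (d * e)%g}.
Proof.
move=> d e; apply: val_inj; apply/funext => -[a A].
by congr pair; rewrite /= mulmxA.
Qed.

HB.instance Definition _ (n : nat) :=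
  isMultiplicative.Build (SL n) (AutGroup (Gamma n)) (@S_aut n) (@S_autM n).

Lemma S_innerP {n : nat} (d : SL n) : (0 < n)%N ->
  IntAut (Gamma n) (S_ d) <-> slmx d = 1%:M \/ slmx d = - 1%:M.
Proof.
move=> n_gt0; split=> [[[g B] _ gE] | d_pm1].
- have gA A : slmx g *m A = A *m d.
    have /(congr1 snd) := congr1 (fun f => f ((1%g, A) : Gamma n)) gE.
    (* Conjugating [(1, A)] by [(g, B)] gives second component [B + g A - B], so [B] drops out. *)
    rewrite /= mulmx1 mulmxN mulmxA mulmxV ?SL_unitmx // mul1mx.
    by rewrite addrAC subrr add0r.
  have gd : slmx g = slmx d by rewrite -[LHS]mulmx1 gA mul1mx.
  have /is_scalar_mxP [a da] : is_scalar_mx (slmx d).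
    by apply: comm_all_is_scalar => A; rewrite -gA gd.
  (* The determinant of [a%:M] is [a ^+ n], and the only integral roots of unity are 1 and -1. *)
  have := det_SL d; rewrite da det_scalar => /(int_exp_eq1 _ _ n_gt0) [] ->.
    by left.
  by right; rewrite raddfN.
- have d_central A : slmx d *m A = A *m d.
    by case: d_pm1 => ->; rewrite ?mulmxN ?mulNmx mul1mx mulmx1.
  (* As [d] is central, conjugation by [(d, 0)] fixes [a] and sends [A] to [d A = A d]. *)
  exists (d, 0) => //; apply/funext => -[a A]; congr pair.
    apply: val_inj; rewrite /= d_central -mulmxA mulmxV ?SL_unitmx //.
    by rewrite mulmx1.
  by rewrite /= mulmx0 oppr0 mulmx0 addr0 add0r d_central.
Qed.

(** In size at least 2 the bottom left corner lies strictly below the diagonal, so the matrix is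
    lower triangular with unit diagonal. *)
Lemma det_transvection {R : comPzRingType} {n : nat} (k : R) :
  \det (1%:M + k *: delta_mx ord_max 0 : 'M[R]_n.+2) == 1.
Proof.
rewrite det_trig; last first.
  apply/is_trig_mxP => i j ltij; rewrite !mxE -val_eqE (ltn_eqF ltij) add0r.
  have j_gt0 := leq_ltn_trans (leq0n i) ltij.
  by rewrite -[j == 0]val_eqE (gtn_eqF j_gt0) andbF mulr0.
rewrite big1 // => i _; rewrite !mxE eqxx.
by case: eqP => [->|_] /=; rewrite mulr0 addr0.
Qed.

Definition transvection {n : nat} (k : int) : SL n.+2 :=
  MkSL (det_transvection k).

(** The factor [c] covers both signs at once: the entry [(0, 0)] forces [c = 1], then the corner
    entries agree. *)
Lemma transvection_scale_inj {n : nat} (j k : int) (c : int) :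
  slmx (@transvection n k) = c *: slmx (@transvection n j) -> j = k.
Proof.
move=> /matrixP kj; have := kj ord_max 0; have := kj 0 0.
rewrite !mxE !eqxx /= !mulr0 !addr0 mulr1 => <-.
by rewrite !add0r mul1r !mulr1.
Qed.

(** The family [F] lives in size [n.+2]. Size 1 must be avoided: [Gamma 1] is infinite cyclic, with
    outer automorphism group of order 2. *)
Lemma Out_Gamma_infinite (n : nat) :
  infinite_set [set: OutGroup (Gamma n.+2)]%classic.
Proof.
pose T (k : nat) : SL n.+2 := transvection k.
pose F k := \pi_(OutGroup (Gamma n.+2))%qT (S_aut (T k)).
have F_inj : injective F.
  move=> j k /out_eqP.
  (* Multiplicativity of [S_aut] reduces equality of two classes to a single [S_] being inner. *)
  have -> : ((S_aut (T j))^-1 * S_aut (T k))%g = S_aut ((T j)^-1 * T k)%g.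
    by rewrite -[RHS](mulKg (S_aut (T j))) -S_autM mulVKg.
  move=> /S_innerP-/(_ isT) jk.
  have [c jkc] : exists c : int, slmx ((T j)^-1 * T k)%g = c%:M.
    by case: jk => ->; [exists 1 | exists (- 1); rewrite raddfN].
  have /transvection_scale_inj [] // : slmx (T k) = c *: slmx (T j).
  by rewrite -mul_mx_scalar -jkc -[in LHS](mulVKg (T j) (T k)).
(* The preimage of a finite set under the injective [F] is finite, which would make [nat] finite. *)
move=> /(finite_preimage (f := F)); rewrite preimage_setT => fin.
by apply: infinite_nat; apply: fin => x y _ _; exact: F_inj.
Qed.

Theorem proposition11 (n : nat) (n_ge3 : (3 <= n)%N) :
  [/\ forall d : SL n, automorphism (S_ d),
      exists Phi : {multiplicative SL n -> AutGroup (Gamma n)},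
        forall d : SL n, aut_fun (Phi d) = S_ d,
      forall d : SL n, IntAut (Gamma n) (S_ d) <->
        slmx d = 1%:M \/ slmx d = - 1%:M
    & infinite_set [set: OutGroup (Gamma n)]%classic].
Proof.
case: n n_ge3 => [|[|n]] // _; split.
- exact: S_automorphism.
- by exists (@S_aut n.+2).
- by move=> d; exact: S_innerP.
- exact: Out_Gamma_infinite.
Qed.
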